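(* The two-variable parity polynomial $\mathbf P_K(x,y)$ is a Vassiliev invariant of order one of virtual knotoids.
   Context: **Virtual knotoids.** A knotoid diagram in $S^2$ is a generic immersion of $[0,1]$ into the oriented sphere $S^2$ with finitely many transverse double points, each endowed with over/under information (classical crossings). The images of $0$ and $1$ are the tail and the head; they are distinct from each other and from all crossings. The diagram is oriented from tail to head. A virtual knotoid diagram may also have virtual crossings (double points marked by a small circle, with no over/under information). A virtual knotoid is an equivalence class of virtual knotoid diagrams under isotopy and the generalized Reidemeister moves: the classical moves $\Omega_1,\Omega_2,\Omega_3$ (performed away from the endpoints); their analogues $\Omega_1^v,\Omega_2^v,\Omega_3^v$ with all crossings virtual; the mixed move $\Omega_3^m$ (a strand having virtual crossings with both strands of a classical crossing is moved across that classical crossing); and the move $\Omega_v$ (an endpoint is moved across a strand, creating or removing a virtual crossing). Moving an endpoint over or under a strand so as to create or remove a classical crossing is forbidden. **Sign.** Draw a classical crossing $c$ with both strands directed upward. Then $\operatorname{sgn}(c)=1$ if the over-strand goes from bottom left to top right, and $\operatorname{sgn}(c)=-1$ if the over-strand goes from bottom right to top left. $C(D)$ is the set of classical crossings of $D$. **Labels and weight.** Arcs are the segments of $D$ between consecutive crossings (or endpoints). Integer labels $\ell$ are assigned to arcs starting from the tail (initial label $0$): at a classical crossing drawn with both strands upward, the label increases by $1$ along the strand going from bottom right to top left and decreases by $1$ along the strand going from bottom left to top right (regardless of over/under); labels do not change at virtual crossings. If at $c$ the incoming arcs are $\alpha$ (bottom left) and $\beta$ (bottom right), the weight is $W_D(c)=\operatorname{sgn}(c)\big(\ell(\alpha)-(\ell(\beta)+1)\big)$.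 **Smoothing, parity, intersection index.** The orientation-preserving smoothing at $c$ (joining the bottom-left incoming arc to the top-left outgoing arc and the bottom-right incoming arc to the top-right outgoing arc) gives an ordered two-component diagram $D_1\cup D_2$: if $\operatorname{sgn}(c)=1$, $D_1$ is the component containing the left smoothed strand and $D_2$ the one containing the right smoothed strand; if $\operatorname{sgn}(c)=-1$, $D_1$ contains the right one and $D_2$ the left one. $I(c)$ is the number of classical crossings between $D_1$ and $D_2$; $c$ is even if $I(c)$ is even and odd otherwise. $E(D)$ and $O(D)$ are the sets of even and odd crossings of $D$. For a classical crossing $e$ between $D_1$ and $D_2$ put $\operatorname{ind}(e)=\operatorname{sgn}(e)$ if $D_1$ is the over-strand at $e$, and $\operatorname{ind}(e)=-\operatorname{sgn}(e)$ if $D_2$ is the over-strand at $e$. The intersection index is $i(c)=\sum_{e\in D_1\cap D_2}\operatorname{ind}(e)$, the sum over classical crossings between $D_1$ and $D_2$. **The polynomial.** For a diagram $D$ of a virtual knotoid $K$, $$\mathbf{P}_K(x,y)=\mathbf{P}_D(x,y)=\sum_{c \in E(D)} \operatorname{sgn}(c)\, i(c)\, x^{W_D(c)} + \sum_{c \in O(D)} \operatorname{sgn}(c)\, i(c)\, y^{W_D(c)}\in\mathbb Z[x^{\pm1},y^{\pm1}],$$ which is an invariant of $K$. **Vassiliev invariants.** A singular virtual knotoid diagram is a virtual knotoid diagram which may in addition have finitely many singular crossings (transverse double points marked by a solid dot, without over/under information); singular virtual knotoids are equivalence classes of such diagrams under the natural extension of the generalized Reidemeister moves. Let $V$ be a virtual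 knotoid invariant with values in an abelian group. For a diagram $D$ with $n\ge1$ singular crossings, let $D_+$ and $D_-$ be obtained by replacing a chosen singular crossing with a positive, respectively negative, classical crossing. The $n$-th derivative is defined recursively by $V^{(0)}(D)=V(D)$ and $V^{(n)}(D)=V^{(n-1)}(D_+)-V^{(n-1)}(D_-)$ for $n\ge1$ (it does not depend on the order in which singular crossings are chosen). $V$ is a Vassiliev invariant of order $n$ if its extension vanishes on all singular virtual knotoids with more than $n$ singular crossings and does not vanish on at least one singular virtual knotoid with exactly $n$ singular crossings. *)

(* Defs.v *)
From HB Require Import structures.
From mathcomp Require Import all_boot all_order all_algebra.
From Stdlib Require Import Relation_Operators.

Set Implicit Arguments.
Unset Strict Implicit.
Unset Printing Implicit Defensive.

Import GRing.Theory.
Local Open Scope nat_scope.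

(* A (singular) virtual knotoid diagram in the oriented sphere is recorded, up
   to isotopy, by the list of the passages through crossings met when
   travelling from the tail to the head.  Virtual crossings are recorded too.
   A passage (x, d, h) is: the name x of the crossing; the direction d, which
   is true when, the crossing being drawn with both strands upward, the
   traversed strand goes from bottom left to top right, and false when it goes
   from bottom right to top left; and the height h of the traversed strand.
   The names and directions determine the cyclic order of the four arcs at
   each crossing, hence a cellular embedding of the underlying graph in a
   closed oriented surface; the diagram lives on the sphere exactly when that
   surface has Euler characteristic 2 (see [planar]), and is then determined up
   to isotopy by this combinatorial map, the underlying graph being
   connected. *)

Variant height := Over | Under | Virtual | Singular.

Lemma height_eq_dec : comparable height.
Proof. by move=> h h'; rewrite /decidable; decide equality. Defined.

HB.instance Definition _ := hasDecEq.Build height (compareP height_eq_dec).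

Definition opposite (h : height) : height :=
  match h with Over => Under | Under => Over | _ => h end.

Definition passage := (nat * bool * height)%type.

Definition name (p : passage) : nat := p.1.1.
Definition dir (p : passage) : bool := p.1.2.
Definition ht (p : passage) : height := p.2.

(* The other passage through the same crossing. *)
Definition partner (p : passage) : passage :=
  (name p, ~~ dir p, opposite (ht p)).

Definition code := seq passage.

Definition well_formed (w : code) : bool :=
  all (fun p => (partner p \in w)
                && (count (fun q => name q == name p) w == 2)) w.

(* The immersed curve, without the over/under/virtual/singular decoration. *)
Definition shadow (w : code) : seq (nat * bool) := [seq p.1 | p <- w].

(* An arc is an element i of 'I_(size f).+1: the one arriving at the i-th
   passage (0-based) and leaving the preceding one.  In [face_next f (i, b)]
   the arc i is traversed forwards if b and backwards otherwise; one then turns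
   left at the crossing (the four arcs at a crossing being, counterclockwise:
   bottom left, bottom right, top right, top left) or turns back at an
   endpoint. *)
Definition face_next (f : seq (nat * bool)) (e : 'I_(size f).+1 * bool)
    : 'I_(size f).+1 * bool :=
  let turn (j : nat) (forward : bool) :=
    let c := nth (0, true) f j in
    let k := index (c.1, ~~ c.2) f in
    if c.2 == forward then (inord k.+1, true) else (inord k, false) in
  if e.2 then (if e.1 == size f :> nat then (e.1, false) else turn e.1 true)
  else (if e.1 == 0 :> nat then (e.1, true) else turn e.1.-1 false).

(* V + F = E + 2, the vertices being the crossings and the two endpoints. *)
Definition planar (f : seq (nat * bool)) : bool :=
  ((size f)./2 + 2) + fcard (@face_next f) predT == (size f).+1 + 2.

Definition is_diagram (w : code) : bool := well_formed w && planar (shadow w).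

Structure diagram := Diagram { code_of :> code; _ : is_diagram code_of }.

HB.instance Definition _ := [isSub for code_of].

(* The number of singular crossings: each has exactly one passage from bottom
   left to top right. *)
Definition nsing (w : code) : nat :=
  count (fun p => dir p && (ht p == Singular)) w.

(* The generalized Reidemeister moves and their extension to singular diagrams.
   Since both sides of a move are later required to be diagrams on the sphere,
   the conditions on directions below say precisely that the arcs involved
   bound a monogon, bigon or triangle face on the relevant side: at a crossing
   the face bounded by two consecutive ends of arcs lies to the left of the
   strand with direction d iff (d == b), where b tells whether the end lying on
   the other strand is outgoing. *)

(* A strand of height h (over, under or virtual at both of its crossings) may be
   moved across a crossing of type h': only a virtual strand may be moved across
   a virtual crossing, while singular crossings may be crossed by any strand. *)
Definition r3_height (h h' : height) : bool :=
  (h != Singular) && ((h' == Virtual) ==> (h == Virtual)).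

Definition orient (b : bool) (p q : passage) : seq passage :=
  if b then [:: p; q] else [:: q; p].

Inductive move : code -> code -> Prop :=
| Move_rename (f : nat -> nat) (w : code) :
    injective f ->
    move w [seq (f (name p), dir p, ht p) | p <- w]
| Move_R1 (p : passage) (w1 w2 : code) :
    ht p != Singular ->
    move (w1 ++ w2) (w1 ++ [:: p; partner p] ++ w2)
  (* The two strands are parallel if b, antiparallel otherwise. *)
| Move_R2 (p q : passage) (b : bool) (s1 s2 w1 w2 w3 : code) :
    ht p != Singular -> ht q = ht p -> dir q = ~~ dir p ->
    perm_eq [:: s1; s2] [:: [:: p; q]; orient b (partner p) (partner q)] ->
    move (w1 ++ w2 ++ w3) (w1 ++ s1 ++ w2 ++ s2 ++ w3)
  (* The strand [:: p; q] is moved across the crossing of r. *)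
| Move_R3 (p q r : passage) (b c : bool) (s1 s2 s3 w1 w2 w3 w4 : code) :
    ht q = ht p -> r3_height (ht p) (ht r) ->
    dir p = (dir r == c) -> dir q = (dir r == b) ->
    perm_eq [:: s1; s2; s3]
      [:: [:: p; q]; orient b (partner p) r;
          orient c (partner q) (partner r)] ->
    move (w1 ++ s1 ++ w2 ++ s2 ++ w3 ++ s3 ++ w4)
         (w1 ++ rev s1 ++ w2 ++ rev s2 ++ w3 ++ rev s3 ++ w4)
| Move_tail (p : passage) (w1 w2 : code) :
    ht p = Virtual ->
    move (w1 ++ w2) (p :: w1 ++ partner p :: w2)
| Move_head (p : passage) (w1 w2 : code) :
    ht p = Virtual ->
    move (w1 ++ w2) (w1 ++ partner p :: w2 ++ [:: p])
  (* A classical crossing (of p) and a singular crossing (of q) forming a bigon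
     are exchanged.  As the directions alternate along a bigon, those of the two
     crossings get exchanged; as the sign of the classical crossing is kept, its
     height is exchanged too: each strand takes the passages of the other. *)
| Move_RS (p q : passage) (b : bool) (s1 s2 s1' s2' w1 w2 w3 : code) :
    ht p \in [:: Over; Under] -> ht q = Singular -> dir q = ~~ dir p ->
    perm_eq [:: (s1, s1'); (s2, s2')]
      [:: ([:: p; q], [:: partner q; partner p]);
          (orient b (partner p) (partner q), orient b q p)] ->
    move (w1 ++ s1 ++ w2 ++ s2 ++ w3) (w1 ++ s1' ++ w2 ++ s2' ++ w3).

(* The classes of this relation on diagrams are the singular virtual knotoids;
   moves preserve nsing, and the classes with nsing = 0 are the virtual
   knotoids. *)
Definition equivalent : diagram -> diagram -> Prop :=
  clos_refl_sym_trans diagram (fun D D' => move D D').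

(* Replacing the singular crossing x by a positive (b = true) or negative
   (b = false) classical crossing. *)
Definition resolve_passage (x : nat) (b : bool) (p : passage) : passage :=
  if (name p == x) && (ht p == Singular)
  then (x, dir p, if dir p == b then Over else Under) else p.

Definition resolve_code (x : nat) (b : bool) (w : code) : code :=
  map (resolve_passage x b) w.

Lemma resolve_passage1 x b p : (resolve_passage x b p).1 = p.1.
Proof.
case: p => [[y d] h]; rewrite /resolve_passage /name /=.
by case: eqP => //= ->; case: ifP.
Qed.

Lemma shadow_resolve x b w : shadow (resolve_code x b w) = shadow w.
Proof.
by rewrite /shadow -map_comp; apply: eq_map => p; rewrite /= resolve_passage1.
Qed.

Lemma resolve_partner x b p :
  resolve_passage x b (partner p) = partner (resolve_passage x b p).
Proof.
case: p => [[y d] h]; rewrite /resolve_passage /partner /name /dir /ht /=.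
by case: (y == x) => //; case: h => //=; case: d; case: b.
Qed.

Lemma resolve_is_diagram x b w : is_diagram w -> is_diagram (resolve_code x b w).
Proof.
rewrite /is_diagram shadow_resolve => /andP[/allP wf ->]; rewrite andbT.
apply/allP => _ /mapP[p pw ->]; have /andP[pw' cw] := wf p pw.
rewrite -resolve_partner map_f //= count_map; apply/eqP.
rewrite -[RHS](eqP cw); apply: eq_count => q /=.
by rewrite /name !resolve_passage1.
Qed.

Definition resolve (x : nat) (b : bool) (D : diagram) : diagram :=
  let: Diagram w dw := D in Diagram (resolve_is_diagram x b dw).

Definition first_singular (w : code) : nat :=
  name (head (0, true, Singular) [seq p <- w | ht p == Singular]).

(* The derivatives do not depend on the order in which the singular crossings
   are resolved; here they are taken in their order along the curve. *)
Fixpoint derivative (A : zmodType) (V : diagram -> A) (n : nat) (D : diagram)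
    : A :=
  if n is n'.+1 then
    let x := first_singular D in
    (derivative V n' (resolve x true D) - derivative V n' (resolve x false D))%R
  else V D.

(* V is used on diagrams without singular crossings only. *)
Definition extension (A : zmodType) (V : diagram -> A) (D : diagram) : A :=
  derivative V (nsing D) D.

(* The first clause says that V is an invariant of virtual knotoids (case
   nsing D = 0, where extension V D = V D) and that its extension is defined on
   singular virtual knotoids. *)
Definition vassiliev_of_order (A : zmodType) (V : diagram -> A) (n : nat)
    : Prop :=
  [/\ forall D D' : diagram, equivalent D D' -> extension V D = extension V D',
      forall D : diagram, n < nsing D -> extension V D = 0%R
    & exists D : diagram, nsing D = n /\ extension V D <> 0%R].

Local Open Scope ring_scope.

(* Each classical crossing has exactly one over-passage. *)
Definition classical (w : code) : seq nat :=
  [seq name p | p <- w & ht p == Over].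

Definition sgn (w : code) (x : nat) : int :=
  if (x, true, Over) \in w then 1 else -1.

Definition label_step (p : passage) : int :=
  if ht p \in [:: Over; Under] then (if dir p then -1 else 1) else 0.

(* The label of the arc arriving at the i-th passage (0-based). *)
Definition label (w : code) (i : nat) : int :=
  \sum_(p <- take i w) label_step p.

Definition position (w : code) (x : nat) (d : bool) : nat :=
  index (x, d) (shadow w).

Definition weight (w : code) (x : nat) : int :=
  sgn w x * (label w (position w x true) - (label w (position w x false) + 1)).

(* Smoothing x cuts off the closed component [inner]; the other component
   [outer] is still an arc from the tail to the head.  The left smoothed strand
   leaves along the top left arc, that is, after the passage with direction
   false; it thus belongs to [outer] iff that passage comes second. *)
Definition inner (w : code) (x : nat) : code :=
  let i := position w x true in let j := position w x false in
  drop (minn i j).+1 (take (maxn i j) w).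

Definition outer (w : code) (x : nat) : code :=
  let i := position w x true in let j := position w x false in
  take (minn i j) w ++ drop (maxn i j).+1 w.

Definition left_comp (w : code) (x : nat) : code :=
  if (position w x true < position w x false)%N then outer w x else inner w x.

Definition right_comp (w : code) (x : nat) : code :=
  if (position w x true < position w x false)%N then inner w x else outer w x.

Definition comp1 (w : code) (x : nat) : code :=
  if sgn w x == 1 then left_comp w x else right_comp w x.

Definition comp2 (w : code) (x : nat) : code :=
  if sgn w x == 1 then right_comp w x else left_comp w x.

Definition passes (s : code) (h : height) (e : nat) : bool :=
  has (fun p => (name p == e) && (ht p == h)) s.

Definition mutual (w : code) (x : nat) : seq nat :=
  [seq e <- classical w |
    passes (comp1 w x) Over e && passes (comp2 w x) Under e
    || passes (comp2 w x) Over e && passes (comp1 w x) Under e].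

Definition even_crossing (w : code) (x : nat) : bool :=
  ~~ odd (size (mutual w x)).

Definition ind (w : code) (x e : nat) : int :=
  if passes (comp1 w x) Over e then sgn w e else - sgn w e.

Definition intersection_index (w : code) (x : nat) : int :=
  \sum_(e <- mutual w x) ind w x e.

(* The Laurent polynomial ring Z[x^+-1, y^+-1] is the subring of this field
   generated by the two variables and their inverses. *)
Definition laurent := {fraction {poly {poly int}}}.

Definition varx : laurent := tofrac ('X%:P : {poly {poly int}}).
Definition vary : laurent := tofrac ('X : {poly {poly int}}).

Definition parity_polynomial (D : diagram) : laurent :=
  \sum_(c <- classical D | even_crossing D c)
      (sgn D c * intersection_index D c)%:~R * varx ^ weight D c
  + \sum_(c <- classical D | ~~ even_crossing D c)
      (sgn D c * intersection_index D c)%:~R * vary ^ weight D c.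

(* Main.v *)
Require Import Defs.
From mathcomp Require Import all_boot all_order all_algebra.
From mathcomp Require Import zify ring.

Set Implicit Arguments.
Unset Strict Implicit.
Unset Printing Implicit Defensive.

Import GRing.Theory.
Local Open Scope ring_scope.

(** The proof rests on a simplification of the polynomial.  Let c be a classical
    crossing and D_1, D_2 the components of its smoothing.  A crossing of D_1
    with itself contributes 0 to the label change along D_1, and a crossing e of
    D_1 with D_2 contributes -ind(e).  Hence -i(c) is the label change along
    D_1, and comparing the labels of the arcs that enter c one finds
    i(c) = -W(c) ([intersection_index_weight]).  As ind(e) = 1 or -1, the parity
    of c is that of W(c).  Therefore P = sum_c sgn(c) g(W(c)), where
    g(n) = -n x^n for even n and g(n) = -n y^n for odd n.

    Moreover W(c) = sgn(c) N(c), where the flat weight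
    N(c) = ell(alpha) - (ell(beta) + 1) only depends on the immersed curve and
    on the set of its classical crossings.  So P = sum_c G(sgn(c), N(c)), with
    G(e, N) = e g(e N) ([parity_polynomialE]), and this formula yields all three
    parts of the statement.

    Vanishing on two or more singular crossings: switching a crossing only
    changes its own term, so the alternating sum over the four resolutions of
    two crossings is 0 ([index_sum_resolve2]).

    Invariance: only diagrams with at most one singular crossing matter, and
    there the extension is a combination of the values of P on the diagrams with
    all singular crossings resolved positively, respectively negatively.  Each
    of these values is invariant ([index_sum_move]), for any g with g(0) = 0:
    the first Reidemeister move creates a crossing of weight 0, the second one
    creates two crossings with equal weights and opposite signs, the third one
    keeps all flat weights, and the exchange of a singular and a classical
    crossing resolves to two second moves or to a renaming.

    Nonvanishing: with one singular crossing c the derivative is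
    g(N(c)) + g(-N(c)), which is y^-1 - y when N(c) is 1 or -1. *)

(** * Flat weights *)

Definition is_classical (p : passage) : bool := ht p \in [:: Over; Under].

Definition label_sum (w : code) : int := \sum_(p <- w) label_step p.

(** For a classical crossing [n] of a diagram with code [w] this is
    ell(alpha) - (ell(beta) + 1), so that the weight of [n] is the sign of [n]
    times [flat_weight 0 w n].  Summing the contributions of the two passages,
    instead of looking their positions up, makes the quantity additive under
    concatenation, as long as the label [a] of the initial arc is kept track
    of.  Over/under information is ignored, so switching crossings leaves it
    unchanged. *)
Fixpoint flat_weight (a : int) (w : code) (n : nat) : int :=
  if w is p :: w' then
    (if (name p == n) && is_classical p
     then if dir p then a else - (a + 1) else 0)
    + flat_weight (a + label_step p) w' n
  else 0.

(** A crossing of sign e and flat weight N contributes e * g (e * N).  It is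
    charged to its passage from bottom left to top right, where the sign can be
    read off from the height. *)
Definition signed_term (A : zmodType) (g : int -> A) (N : int) (p : passage)
    : A :=
  if dir p then
    match ht p with Over => g N | Under => - g (- N) | _ => 0 end
  else 0.

Definition index_sum (A : zmodType) (g : int -> A) (w : code) : A :=
  \sum_(p <- w) signed_term g (flat_weight 0 w (name p)) p.

Lemma partnerK : involutive partner.
Proof. by case=> [[n d] []]; rewrite /partner /name /dir /= negbK. Qed.

Lemma label_step_partner p : label_step (partner p) = - label_step p.
Proof. by case: p => [[n []] []]. Qed.

Lemma label_sum_cat u v : label_sum (u ++ v) = label_sum u + label_sum v.
Proof. exact: big_cat. Qed.

Lemma label_sum_cons p u : label_sum (p :: u) = label_step p + label_sum u.
Proof. exact: big_cons. Qed.

Lemma label_sum_nil : label_sum [::] = 0.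
Proof. exact: big_nil. Qed.

Definition label_sumE := (label_sum_cat, label_sum_cons, label_sum_nil).

Lemma label_sum_perm u v : perm_eq u v -> label_sum u = label_sum v.
Proof. exact: perm_big. Qed.

Lemma flat_weight_cat a u v n :
  flat_weight a (u ++ v) n
  = flat_weight a u n + flat_weight (a + label_sum u) v n.
Proof.
elim: u a => [|p u IHu] a /=; first by rewrite label_sum_nil addr0 add0r.
by rewrite IHu label_sum_cons !addrA.
Qed.

(** Each passage of [n] enters with the sign opposite to its label step. *)
Lemma flat_weight_base a w n :
  flat_weight a w n
  = flat_weight 0 w n - a * label_sum [seq p <- w | name p == n].
Proof.
elim: w a => [|p w IHw] a /=; first by rewrite label_sum_nil; lia.
rewrite IHw [X in _ = _ + X - _]IHw; case: (name p == n) => /=; last first.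
  by lia.
rewrite label_sum_cons /label_step /is_classical.
by case: (ht p \in _); case: (dir p); lia.
Qed.

Lemma flat_weight_fresh a w n : n \notin map name w -> flat_weight a w n = 0.
Proof.
elim: w a => //= p w IHw a; rewrite inE negb_or eq_sym => /andP[/negPf-> nw].
by rewrite IHw ?addr0.
Qed.

Lemma flat_weight_classical a w n :
  flat_weight a [seq p <- w | is_classical p] n = flat_weight a w n.
Proof.
elim: w a => //= p w IHw a; case: ifP => pc /=; rewrite IHw ?pc //.
by rewrite andbF add0r /label_step -/(is_classical p) pc addr0.
Qed.

(** Crossings that are not classical can be erased, which settles the moves
    [Move_tail] and [Move_head]. *)
Lemma index_sum_classical (A : zmodType) (g : int -> A) w :
  index_sum g [seq p <- w | is_classical p] = index_sum g w.
Proof.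
rewrite /index_sum big_filter big_mkcond; apply: eq_bigr => p _.
rewrite flat_weight_classical; case: ifP => //.
by rewrite /is_classical /signed_term; case: (ht p); case: (dir p).
Qed.

Lemma flat_weight_rename a (f : nat -> nat) w n :
  injective f ->
  flat_weight a [seq (f (name p), dir p, ht p) | p <- w] (f n)
  = flat_weight a w n.
Proof.
move=> f_inj; elim: w a => //= p w IHw a.
by rewrite IHw /is_classical /name /= (inj_eq f_inj).
Qed.

Lemma index_sum_rename (A : zmodType) (g : int -> A) (f : nat -> nat) w :
  injective f ->
  index_sum g [seq (f (name p), dir p, ht p) | p <- w] = index_sum g w.
Proof.
move=> f_inj; rewrite /index_sum big_map; apply: eq_bigr => p _.
rewrite -[in RHS](flat_weight_rename _ _ _ f_inj).
by case: p => [[n []] h].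
Qed.

(** * Reidemeister moves *)

(** The crossing of a kink has weight 0; its two label steps cancel, so nothing
    changes elsewhere. *)
Lemma index_sum_R1 (A : zmodType) (g : int -> A) (p : passage) (w1 w2 : code) :
  g 0 = 0 -> name p \notin map name (w1 ++ w2) ->
  index_sum g (w1 ++ [:: p; partner p] ++ w2) = index_sum g (w1 ++ w2).
Proof.
move=> g0 p_fresh; set w := _ ++ _ ++ _.
have fw n : flat_weight 0 w n = flat_weight 0 (w1 ++ w2) n.
  rewrite /w !flat_weight_cat !label_sumE /= label_step_partner.
  rewrite !(addr0, add0r, subrr).
  congr (_ + _); rewrite -[RHS]add0r; congr (_ + _); move: (label_sum w1) => l.
  case: p {p_fresh w} => [[x []] []];
    rewrite /name /label_step /is_classical /ht /dir /= ?inE /=;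
    case: (x == n) => /=; lia.
rewrite /index_sum (eq_bigr _ (fun q _ => congr1 (fun N => _ N _) (fw _))).
rewrite !big_cat /= !big_cons big_nil addr0.
rewrite [X in _ + (X + _)](_ : _ = 0) ?add0r // [name (partner p)]/=.
rewrite flat_weight_fresh //.
by case: p {w fw p_fresh} => [[x []] []];
  rewrite /signed_term /= ?oppr0 ?g0 ?oppr0 ?addr0.
Qed.

Lemma perm_eq_pair (T : eqType) (x y u v : T) :
  perm_eq [:: x; y] [:: u; v] -> (x = u /\ y = v) \/ (x = v /\ y = u).
Proof.
move=> xy_uv; have /perm_mem/(_ x) := xy_uv; rewrite !inE eqxx /=.
case/esym/orP=> /eqP xE; subst x.
  by move: xy_uv; rewrite perm_cons => /perm_small_eq-/(_ isT)[->]; left.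
move: xy_uv; rewrite perm_sym -(perm_rot 1) /= perm_cons.
by move=> /perm_small_eq-/(_ isT)[->]; right.
Qed.

(** The two crossings of a bigon with one strand on top have opposite signs and
    opposite flat weights N, -N, hence the same weight: their terms cancel.
    Along each of the two strands the label steps cancel, so the other crossings
    do not notice the bigon. *)
Lemma index_sum_R2 (A : zmodType) (g : int -> A) (p q : passage) (b : bool)
    (s1 s2 w1 w2 w3 : code) :
  ht q = ht p -> dir q = ~~ dir p -> name q != name p ->
  name p \notin map name (w1 ++ w2 ++ w3) ->
  name q \notin map name (w1 ++ w2 ++ w3) ->
  perm_eq [:: s1; s2] [:: [:: p; q]; orient b (partner p) (partner q)] ->
  index_sum g (w1 ++ s1 ++ w2 ++ s2 ++ w3) = index_sum g (w1 ++ w2 ++ w3).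
Proof.
move=> hq dq npq p_fresh q_fresh s12; set w := _ ++ _ ++ _ ++ _.
have s12_0 : label_sum s1 = 0 /\ label_sum s2 = 0.
  have t1 : label_sum [:: p; q] = 0.
    by rewrite !label_sumE /label_step hq dq; case: (_ \in _); case: (dir p).
  have t2 : label_sum (orient b (partner p) (partner q)) = 0.
    by case: b {s12}; rewrite /= !label_sumE !label_step_partner;
      move: t1; rewrite !label_sumE; lia.
  by case: (perm_eq_pair s12) => -[-> ->].
have [s1_0 s2_0] := s12_0.
(* The labels on the arcs entering the two strands of the bigon. *)
pose a1 := label_sum w1; pose a2 := label_sum w1 + label_sum w2.
have fw n : flat_weight 0 w n = flat_weight 0 (w1 ++ w2 ++ w3) n
    + (flat_weight a1 s1 n + flat_weight a2 s2 n).
  rewrite /w !flat_weight_cat s1_0 s2_0 !addr0 !add0r -/a1 -/a2.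
  by ring.
have fw_old n : n != name p -> n != name q ->
    flat_weight 0 w n = flat_weight 0 (w1 ++ w2 ++ w3) n.
  move=> np nq; rewrite fw -[RHS]addr0; congr (_ + _).
  rewrite ![flat_weight _ _ n]flat_weight_fresh ?addr0 //.
    by case: (perm_eq_pair s12) => -[_ ->]; case: (b);
      rewrite /= ?[name (partner _)]/= !inE negb_or ?np ?nq.
  by case: (perm_eq_pair s12) => -[-> _]; case: (b);
    rewrite /= ?[name (partner _)]/= !inE negb_or ?np ?nq.
have old u : {subset u <= w1 ++ w2 ++ w3} ->
    \sum_(r <- u) signed_term g (flat_weight 0 w (name r)) r
    = \sum_(r <- u)
        signed_term g (flat_weight 0 (w1 ++ w2 ++ w3) (name r)) r.
  move=> u_sub; apply: eq_big_seq => r /u_sub rw; rewrite fw_old //.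
    by apply: contraNneq p_fresh => <-; rewrite map_f.
  by apply: contraNneq q_fresh => <-; rewrite map_f.
have w_perm : perm_eq w ([:: p; q; partner p; partner q] ++ w1 ++ w2 ++ w3).
  apply/permP=> a; rewrite /w !count_cat.
  by case: (perm_eq_pair s12) => -[-> ->]; case: (b) => /=; lia.
rewrite /index_sum -old // (perm_big _ w_perm) big_cat /=.
rewrite -[RHS]add0r; congr (_ + _).
rewrite !big_cons big_nil addr0 ![name (partner _)]/= !fw.
rewrite ![flat_weight 0 _ _]flat_weight_fresh // !add0r.
have {}s12 := perm_eq_pair s12.
clear p_fresh q_fresh w fw fw_old old w_perm s12_0 s1_0 s2_0.
move: a1 a2 => a1 a2.
case: p q hq dq npq s12 => [[x d] h] [[y e] k].
rewrite /ht /dir /name /= => -> -> nyx.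
have nxy : (x == y) = false by rewrite eq_sym (negPf nyx).
case=> -[-> ->]; case: b; case: h; case: d;
  rewrite /signed_term /is_classical /name /dir /ht /= ?inE /=
    ?eqxx ?nxy ?(negPf nyx) /= ?(addr0, add0r, oppr0) //
    ?label_step_partner /label_step /=; apply/eqP;
  rewrite ?[- _ + _]addrC subr_eq0; apply/eqP; congr (g _); lia.
Qed.

(** By [flat_weight_base] the effect of reversing a block does not depend on the
    label with which it is entered, as the base label is multiplied by the same
    number on both sides.  For the third Reidemeister move the total effect is
    therefore a sum over the three blocks, in which their order along the curve
    is irrelevant. *)
Definition reversal_change (s : code) (n : nat) : int :=
  flat_weight 0 s n - flat_weight 0 (rev s) n.

Lemma flat_weight_rev a s n :
  flat_weight a (rev s) n = flat_weight a s n - reversal_change s n.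
Proof.
rewrite /reversal_change flat_weight_base (flat_weight_base a s).
rewrite filter_rev (label_sum_perm (v := [seq p <- s | name p == n])).
  by ring.
by rewrite perm_rev.
Qed.

Lemma label_sum_rev s : label_sum (rev s) = label_sum s.
Proof. by apply: label_sum_perm; rewrite perm_rev. Qed.

(** Each crossing of the triangle lies on two of its sides.  Reversing a side
    shifts the label at each of its two crossings by the label step of the other
    one; the conditions on directions say that the two shifts at a crossing
    compensate each other in its flat weight. *)
Lemma index_sum_R3 (A : zmodType) (g : int -> A) (p q r : passage) (b c : bool)
    (s1 s2 s3 w1 w2 w3 w4 : code) :
  ht q = ht p -> (is_classical p ==> is_classical r) ->
  dir p = (dir r == c) -> dir q = (dir r == b) ->
  perm_eq [:: s1; s2; s3]
    [:: [:: p; q]; orient b (partner p) r;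
        orient c (partner q) (partner r)] ->
  index_sum g (w1 ++ s1 ++ w2 ++ s2 ++ w3 ++ s3 ++ w4)
  = index_sum g (w1 ++ rev s1 ++ w2 ++ rev s2 ++ w3 ++ rev s3 ++ w4).
Proof.
move=> hq clpr dp dq s123.
have fw n : flat_weight 0 (w1 ++ s1 ++ w2 ++ s2 ++ w3 ++ s3 ++ w4) n
    = flat_weight 0 (w1 ++ rev s1 ++ w2 ++ rev s2 ++ w3 ++ rev s3 ++ w4) n.
  rewrite !flat_weight_cat !label_sum_rev !flat_weight_rev.
  suff : \sum_(s <- [:: s1; s2; s3]) reversal_change s n = 0.
    rewrite !big_cons big_nil addr0 => /eqP.
    by rewrite addrA addr_eq0 => /eqP; lia.
  rewrite (perm_big _ s123) /= !big_cons big_nil addr0.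
  rewrite /reversal_change.
  case: p q r hq clpr dp dq {s123} => [[x d] h] [[y e] k] [[z f] l].
  rewrite /ht /dir /is_classical /name /= => -> clpr -> ->.
  case: b; case: c; case: f;
    rewrite /= /is_classical /label_step /name /ht /dir /=;
    move: clpr; case: h; case: l => //= _; rewrite ?inE /=;
    case: (x == n); case: (y == n); case: (z == n) => /=; lia.
rewrite /index_sum (eq_bigr _ (fun q _ => congr1 (fun N => _ N _) (fw _))).
apply: perm_big; apply/permP=> a; rewrite !count_cat !count_rev; lia.
Qed.

(** * Invariance of the resolved diagrams *)

(** All singular crossings are resolved with the same sign.  For a diagram with
    a single singular crossing this is its resolution, but it does not mention
    the name of that crossing, and so it is compatible with all the moves. *)
Definition resolve_all_passage (b : bool) (p : passage) : passage :=
  (p.1, if ht p == Singular then if dir p == b then Over else Under else ht p).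

Definition resolve_all (b : bool) (w : code) : code :=
  map (resolve_all_passage b) w.

Lemma resolve_all_partner b p :
  resolve_all_passage b (partner p) = partner (resolve_all_passage b p).
Proof. by case: b; case: p => [[n []] []]. Qed.

Lemma names_resolve_all b w : map name (resolve_all b w) = map name w.
Proof. by rewrite -map_comp. Qed.

Lemma resolve_all_orient b c p q :
  resolve_all b (orient c p q)
  = orient c (resolve_all_passage b p) (resolve_all_passage b q).
Proof. by case: c. Qed.

Lemma resolve_all_id b w :
  nsing w = 0%N -> well_formed w -> resolve_all b w = w.
Proof.
move=> ns wf; rewrite -[RHS]map_id; apply/eq_in_map => p pw.
rewrite /resolve_all_passage; case: eqP => [hp|]; last by case: p {pw}.
have /allP/(_ p pw)/andP[p'w _] := wf.
have : has (fun p => dir p && (ht p == Singular)) w.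
  apply/hasP; case dp: (dir p); first by exists p; rewrite ?dp ?hp.
  exists (partner p) => //.
  by rewrite /partner /dir /ht /= -/(dir p) -/(ht p) dp hp.
by rewrite has_count -[count _ _]/(nsing w) ns.
Qed.

Lemma fresh_pair w p r : well_formed w -> perm_eq w (p :: partner p :: r) ->
  name p \notin map name r.
Proof.
move=> /allP wf wE; have /wf/andP[_] : p \in w.
  by rewrite (perm_mem wE) mem_head.
rewrite (permP wE) /= !eqxx => /eqP[/eqP c0].
by rewrite -has_pred1 has_map has_count -leqNgt leqn0.
Qed.

(** A singular and a classical crossing that form a bigon, after resolution.  If
    one strand passes over at both crossings, then both sides of the move arise
    from the same diagram by second Reidemeister moves.  Otherwise the two
    crossings have the same sign, and exchanging them amounts to exchanging
    their names. *)
Lemma index_sum_RS (A : zmodType) (g : int -> A) (p q : passage) (b : bool)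
    (s1 s2 s1' s2' w1 w2 w3 : code) :
  is_classical p -> is_classical q -> dir q = ~~ dir p -> name q != name p ->
  name p \notin map name (w1 ++ w2 ++ w3) ->
  name q \notin map name (w1 ++ w2 ++ w3) ->
  perm_eq [:: (s1, s1'); (s2, s2')]
    [:: ([:: p; q], [:: partner q; partner p]);
        (orient b (partner p) (partner q), orient b q p)] ->
  index_sum g (w1 ++ s1 ++ w2 ++ s2 ++ w3)
  = index_sum g (w1 ++ s1' ++ w2 ++ s2' ++ w3).
Proof.
move=> clp clq dq nqp p_fresh q_fresh s12.
have [hq|hq] : ht q = ht p \/ ht q = opposite (ht p).
- by move: clp clq; rewrite /is_classical; case: (ht p); case: (ht q); auto.
- transitivity (index_sum g (w1 ++ w2 ++ w3)).
    exact: index_sum_R2 hq dq nqp p_fresh q_fresh (perm_map fst s12).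
  have := perm_map snd s12.
  rewrite /= -{2}(partnerK p) -{2}(partnerK q) => s12'.
  apply/esym/(index_sum_R2 _ _ _ _ _ _ s12') => //; last by rewrite eq_sym.
  + by rewrite /partner /ht /= -/(ht p) -/(ht q) hq.
  + by rewrite /partner /dir /= -/(dir p) -/(dir q) dq negbK.
pose f n := if n == name p then name q else if n == name q then name p else n.
have f_inv : involutive f.
  move=> n; rewrite /f; case: (eqVneq n (name p)) => [->|np].
    by rewrite (negPf nqp) eqxx.
  case: (eqVneq n (name q)) => [->|nq]; first by rewrite eqxx.
  by rewrite (negPf np) (negPf nq).
pose ren (r : passage) : passage := (f (name r), dir r, ht r).
have ren_fresh u : {subset u <= w1 ++ w2 ++ w3} -> map ren u = u.
  move=> u_sub; rewrite -[RHS]map_id; apply/eq_in_map => r /u_sub rw.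
  rewrite /ren /f ifN; last by apply: contraNneq p_fresh => <-; rewrite map_f.
  rewrite ifN; last by apply: contraNneq q_fresh => <-; rewrite map_f.
  by case: r {rw} => [[]].
rewrite -[LHS](index_sum_rename g _ (inv_inj f_inv)) -/ren !map_cat.
rewrite !(ren_fresh w1, ren_fresh w2, ren_fresh w3);
  try by move=> r rw; rewrite !mem_cat rw ?orbT.
have [rp rq rp' rq'] : [/\ ren p = partner q, ren q = partner p,
    ren (partner p) = q & ren (partner q) = p].
  have fp : f (name p) = name q by rewrite /f eqxx.
  have fq : f (name q) = name p by rewrite -fp f_inv.
  have hp : ht p = opposite (ht q) by rewrite hq; case: (ht p).
  rewrite /ren; split.
  - by rewrite fp /partner dq negbK -hp.
  - by rewrite fq /partner -dq -hq.
  - rewrite -[f _]/(f (name p)) fp.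
    rewrite -[dir _]/(~~ dir p) -[ht _]/(opposite (ht p)).
    by rewrite -dq -hq; case: (q) => [[]].
  rewrite -[f _]/(f (name q)) fq.
  rewrite -[dir _]/(~~ dir q) -[ht _]/(opposite (ht q)).
  by rewrite dq negbK -hp; case: (p) => [[]].
by case: (perm_eq_pair s12) => -[[-> ->] [-> ->]]; case: (b);
  rewrite /= ?rp ?rq ?rp' ?rq'.
Qed.

Lemma fresh_pair2 w p q r :
  well_formed w -> perm_eq w (p :: partner p :: q :: partner q :: r) ->
  [/\ name q != name p, name p \notin map name r & name q \notin map name r].
Proof.
move=> wf wE; have := fresh_pair wf wE.
rewrite /= !inE !negb_or => /and3P[npq _ p_r].
have /(fresh_pair wf) : perm_eq w (q :: partner q :: p :: partner p :: r).
  by apply: perm_trans wE _; apply/permP=> a /=; lia.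
by rewrite /= !inE !negb_or => /and3P[-> _ q_r].
Qed.

Lemma index_sum_move (A : zmodType) (g : int -> A) (b : bool) (w w' : code) :
  g 0 = 0 -> move w w' -> well_formed w -> well_formed w' ->
  index_sum g (resolve_all b w) = index_sum g (resolve_all b w').
Proof.
move=> g0 [] {w w'}.
- move=> f w f_inj _ _; rewrite -[LHS](index_sum_rename g _ f_inj).
  by congr index_sum; rewrite /resolve_all -!map_comp.
- move=> p w1 w2 _ _ wf'.
  have p_fresh : name p \notin map name (w1 ++ w2).
    apply: (fresh_pair wf'); apply/permP=> a.
    by rewrite !count_cat /= count_cat; lia.
  rewrite /resolve_all !map_cat /= resolve_all_partner.
  by rewrite [RHS]index_sum_R1 -?map_cat ?names_resolve_all.
- move=> p q c s1 s2 w1 w2 w3 hp hq dq s12 _ wf'.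
  have wE : perm_eq (w1 ++ s1 ++ w2 ++ s2 ++ w3)
      [:: p, partner p, q, partner q & w1 ++ w2 ++ w3].
    apply/permP=> a; rewrite /= !count_cat.
    by case: (perm_eq_pair s12) => -[-> ->]; case: (c) => /=; lia.
  have [nqp p_fresh q_fresh] := fresh_pair2 wf' wE.
  rewrite /resolve_all !map_cat; apply/esym.
  have := perm_map (resolve_all b) s12.
  rewrite /= resolve_all_orient !resolve_all_partner.
  apply: index_sum_R2; rewrite -?map_cat ?names_resolve_all //.
  by rewrite /resolve_all_passage /ht /= -/(ht p) -/(ht q) hq; case: (ht p) hp.
- move=> p q r c d s1 s2 s3 w1 w2 w3 w4 hq hr dp dq s123 _ _.
  rewrite /resolve_all !(map_cat, map_rev).
  apply: (index_sum_R3 g (p := resolve_all_passage b p)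
    (q := resolve_all_passage b q) (r := resolve_all_passage b r)
    (b := c) (c := d)) => //.
  + rewrite /resolve_all_passage /ht /= -/(ht p) -/(ht q) hq dp dq.
    by move: hr; case: (ht p).
  + by move: hr; rewrite /r3_height /is_classical /resolve_all_passage /ht /=
      -/(ht p) -/(ht r); case: (ht p); case: (ht r) => //=; case: ifP.
  + have := perm_map (resolve_all b) s123.
    by rewrite /= !resolve_all_orient !resolve_all_partner.
- move=> p w1 w2 hp _ _; rewrite -index_sum_classical -[RHS]index_sum_classical.
  rewrite /resolve_all !(map_cat, map_cons) resolve_all_partner.
  by rewrite /= !filter_cat /= ?filter_cat /= /is_classical /resolve_all_passage
    /partner /ht /= -/(ht p) hp /=.
- move=> p w1 w2 hp _ _; rewrite -index_sum_classical -[RHS]index_sum_classical.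
  rewrite /resolve_all !(map_cat, map_cons) resolve_all_partner.
  by rewrite /= !filter_cat /= ?filter_cat /= /is_classical /resolve_all_passage
    /partner /ht /= -/(ht p) hp /= cats0.
- move=> p q c s1 s2 s1' s2' w1 w2 w3 hp hq dq s12 wf _.
  have wE : perm_eq (w1 ++ s1 ++ w2 ++ s2 ++ w3)
      [:: p, partner p, q, partner q & w1 ++ w2 ++ w3].
    apply/permP=> a; rewrite /= !count_cat.
    by case: (perm_eq_pair s12) => -[[-> _] [-> _]]; case: (c) => /=; lia.
  have [nqp p_fresh q_fresh] := fresh_pair2 wf wE.
  rewrite /resolve_all !map_cat.
  have := perm_map (fun s => (resolve_all b s.1, resolve_all b s.2)) s12.
  rewrite /= !resolve_all_orient !resolve_all_partner.
  apply: index_sum_RS; rewrite -?map_cat ?names_resolve_all //.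
    rewrite /is_classical /resolve_all_passage /ht /= -/(ht p).
    by case: (ht p) hp.
  rewrite /is_classical /resolve_all_passage /ht /= -/(ht q) hq /=.
  by case: ifP.
Qed.

(** * Well-formed codes *)

Lemma names_count w p : well_formed w -> p \in w ->
  count (fun q => name q == name p) w = 2%N /\ partner p \in w.
Proof. by move=> /allP wf /wf/andP[-> /eqP]. Qed.

Lemma partner_neq p : (partner p == p) = false.
Proof. by apply/eqP=> /(congr1 dir); rewrite /partner /dir /=; case: p.1.2. Qed.

Lemma well_formed_split w p : well_formed w -> p \in w ->
  exists q u v t, [/\ q = p \/ q = partner p,
    w = u ++ q :: v ++ partner q :: t & name p \notin map name (u ++ v ++ t)].
Proof.
move=> wf pw; have [_ p'w] := names_count wf pw.
have [q [u [v [t [qp wE]]]]] : exists q u v t, (q = p \/ q = partner p) /\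
    w = u ++ q :: v ++ partner q :: t.
  case/splitPr: pw p'w {wf} => u v; rewrite mem_cat inE partner_neq /=.
  case/orP=> [/splitPr[u1 u2] | /splitPr[v1 v2]].
    exists (partner p), u1, u2, v; rewrite partnerK -catA; split=> //; by right.
  by exists p, u, v1, v2; split=> //; left.
exists q, u, v, t; split=> //.
have -> : name p = name q by case: qp => ->.
apply: (fresh_pair wf); rewrite wE; apply/permP=> a.
by rewrite !count_cat /= !count_cat /=; lia.
Qed.

Lemma well_formed_uniq w : well_formed w -> uniq w.
Proof.
move=> wf; apply: count_mem_uniq => p.
case: (boolP (p \in w)) => pw; last exact/count_memPn.
have [q [u [v [t [qp wE]]]]] := well_formed_split wf pw.
have fresh s r : name r = name p -> name p \notin map name s ->
    count_mem r s = 0%N.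
  move=> rp; apply: contraNeq.
  by rewrite -lt0n -has_count has_pred1 -rp; apply: map_f.
rewrite !map_cat !mem_cat !negb_or => /and3P[pu pv pt].
rewrite wE count_cat /= count_cat /= !(fresh _ p) //=.
by case: qp => ->; rewrite ?partnerK eqxx ?partner_neq // eq_sym partner_neq.
Qed.

Lemma same_crossing w p q : well_formed w -> p \in w -> q \in w ->
  name q = name p -> q = p \/ q = partner p.
Proof.
move=> wf pw qw qp; have [r [u [v [t [rp wE]]]]] := well_formed_split wf pw.
move=> fresh; move: qw; rewrite wE !(mem_cat, inE).
have nq s : name p \notin map name s -> q \in s = false.
  by move=> ps; apply: contraNF ps => qs; rewrite -qp map_f.
move: fresh; rewrite !map_cat !mem_cat !negb_or => /and3P[pu pv pt].
rewrite !nq //= orbF; case/orP=> /eqP ->; first by [].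
by case: rp => ->; rewrite ?partnerK; auto.
Qed.

Lemma same_passage w p q : well_formed w -> p \in w -> q \in w ->
  name q = name p -> ht q = ht p -> is_classical p -> q = p.
Proof.
move=> wf pw qw qp hq clp; case: (same_crossing wf pw qw qp) => // qE.
by move: hq clp; rewrite qE /is_classical; case: p {pw qw qp qE} => [[x d] []].
Qed.

(* The names of the passages at height h. *)
Definition names_at (h : height) (w : code) : seq nat :=
  [seq name p | p <- w & ht p == h].

Lemma names_atP h w n : reflect (exists2 p, p \in w & ht p = h /\ name p = n)
  (n \in names_at h w).
Proof.
apply: (iffP mapP) => [[p]|[p pw [hp pn]]].
  by rewrite mem_filter => /andP[/eqP hp pw] ->; exists p.
by exists p; rewrite // mem_filter hp eqxx.
Qed.

Lemma passesP s h e : reflect (exists2 p, p \in s & ht p = h /\ name p = e)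
  (passes s h e).
Proof.
apply: (iffP hasP) => -[p ps].
  by case/andP=> /eqP pe /eqP hp; exists p.
by case=> hp pe; exists p; rewrite // hp pe !eqxx.
Qed.

Lemma passes_names s h e : passes s h e = (e \in names_at h s).
Proof. by apply/passesP/names_atP. Qed.

Lemma names_at_uniq h w s : well_formed w -> {subset s <= w} -> uniq s ->
  h \in [:: Over; Under] -> uniq (names_at h s).
Proof.
move=> wf sw us hc; rewrite map_inj_in_uniq ?filter_uniq // => p q.
rewrite !mem_filter => /andP[/eqP hp ps] /andP[/eqP hq qs] pq.
apply/esym/(same_passage wf (sw _ ps) (sw _ qs)); rewrite ?pq ?hp //.
by rewrite /is_classical hp.
Qed.

Lemma names_at_partner h w : well_formed w ->
  {subset names_at h w <= names_at (opposite h) w}.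
Proof.
move=> wf n /names_atP[p pw [hp pn]]; have [_ p'w] := names_count wf pw.
by apply/names_atP; exists (partner p); rewrite // -hp.
Qed.

Lemma classical_Under w : well_formed w -> classical w =i names_at Under w.
Proof. by move=> wf n; apply/idP/idP; apply: names_at_partner. Qed.

Definition dir_sign (d : bool) : int := if d then 1 else -1.

Lemma sgn_passage w p : well_formed w -> p \in w -> is_classical p ->
  sgn w (name p) = dir_sign (dir p == (ht p == Over)).
Proof.
move=> wf pw clp; rewrite /sgn.
have [_ p'w] := names_count wf pw.
suff -> : ((name p, true, Over) \in w) = (dir p == (ht p == Over)) by [].
apply/idP/idP=> [ow|].
  case: (same_crossing wf pw ow erefl) => [pE|]; first by rewrite -pE.
  rewrite /partner => -[]; move: clp; rewrite /is_classical.
  by case: (ht p); case: (dir p).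
case: p clp pw p'w => [[x d] h].
rewrite /is_classical /partner /dir /ht /name /=.
by case: h; case: d.
Qed.

(** Summing signs over the crossings that [s] passes at height [h] is summing
    over the passages of [s] at that height: a crossing has at most one of
    them. *)
Lemma sum_passes w s h : well_formed w -> {subset s <= w} -> uniq s ->
  h \in [:: Over; Under] ->
  \sum_(e <- classical w | passes s h e) sgn w e
  = \sum_(p <- s | ht p == h) dir_sign (dir p == (h == Over)).
Proof.
move=> wf sw us hc.
have -> : \sum_(p <- s | ht p == h) dir_sign (dir p == (h == Over))
    = \sum_(e <- names_at h s) sgn w e.
  rewrite big_map big_filter [LHS]big_seq_cond [RHS]big_seq_cond.
  apply: eq_bigr => p /andP[ps /eqP hp].
  by rewrite (sgn_passage wf (sw _ ps)) /is_classical hp.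
rewrite -big_filter; apply: perm_big; apply: uniq_perm.
- by rewrite filter_uniq // (names_at_uniq wf (h := Over)) // well_formed_uniq.
- exact: (names_at_uniq wf sw us hc).
move=> e; rewrite mem_filter passes_names andb_idr // => es.
have : e \in names_at h w.
  by case/names_atP: es => p /sw pw [hp pe]; apply/names_atP; exists p.
by move: hc; rewrite !inE => /orP[]/eqP-> //; rewrite -classical_Under.
Qed.

(** The label step at an over-passage is minus the sign of the crossing, and at
    an under-passage it is the sign. *)
Lemma label_sum_passes w s : well_formed w -> {subset s <= w} -> uniq s ->
  \sum_(e <- classical w)
     sgn w e * ((passes s Over e)%:R - (passes s Under e)%:R)
  = - label_sum s.
Proof.
move=> wf sw us.
have -> : \sum_(e <- classical w)
      sgn w e * ((passes s Over e)%:R - (passes s Under e)%:R)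
    = \sum_(e <- classical w | passes s Over e) sgn w e
      - \sum_(e <- classical w | passes s Under e) sgn w e.
  rewrite [X in _ = X - _]big_mkcond [X in _ = _ - X]big_mkcond -sumrB.
  apply: eq_bigr => e _.
  by case: (passes s Over e); case: (passes s Under e); lia.
rewrite !sum_passes // [X in X - _ = _]big_mkcond [X in _ - X = _]big_mkcond.
rewrite /label_sum -sumrB -sumrN.
by apply: eq_bigr => -[[x []] []].
Qed.

Lemma label_sum_well_formed w : well_formed w -> label_sum w = 0.
Proof.
move=> wf; apply/oppr_inj; rewrite -(label_sum_passes wf) ?well_formed_uniq //.
rewrite oppr0 big_seq big1 // => e ew.
rewrite !passes_names -classical_Under //.
rewrite -[e \in names_at _ _]/(e \in classical w).
by rewrite ew subrr mulr0.
Qed.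

(** * Smoothings and the intersection index *)

Lemma passes_cat s t h e : passes (s ++ t) h e = passes s h e || passes t h e.
Proof. exact: has_cat. Qed.

Lemma passes_well_formed w h e : well_formed w -> h \in [:: Over; Under] ->
  passes w h e = (e \in classical w).
Proof.
move=> wf; rewrite passes_names !inE => /orP[]/eqP-> //.
by rewrite classical_Under.
Qed.

Lemma passes_fresh s h e : e \notin map name s -> passes s h e = false.
Proof.
by apply: contraNF => /passesP[p ps [_ <-]]; apply: map_f.
Qed.

Lemma passes_complement w p s t h e :
  well_formed w -> perm_eq w [:: p, partner p & s ++ t] ->
  h \in [:: Over; Under] -> e \in classical w -> e != name p ->
  passes t h e = ~~ passes s h e.
Proof.
move=> wf wE hc ew ep.
have : passes w h e by rewrite passes_well_formed.
rewrite [passes w h e](perm_has _ wE) /= [name (partner p)]/=.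
rewrite eq_sym (negPf ep) /=.
rewrite -[has _ _]/(passes (s ++ t) h e) passes_cat.
case: (boolP (passes t h e)) => tP; last by rewrite orbF => ->.
move=> _; apply/esym; apply: contraTN isT => sP.
have [r rs [hr re]] := passesP _ _ _ sP.
have [r' r't [hr' re']] := passesP _ _ _ tP.
have sub x : x \in s ++ t -> x \in w.
  by move=> xst; rewrite (perm_mem wE) !inE xst !orbT.
have rr' : r' = r.
  have rw : r \in w by rewrite sub // mem_cat rs.
  have r'w : r' \in w by rewrite sub // mem_cat r't orbT.
  by apply: (same_passage wf rw r'w); rewrite ?re' ?hr' // /is_classical hr.
have := well_formed_uniq wf; rewrite (perm_uniq wE) /= => /and3P[_ _].
by rewrite cat_uniq => /and3P[_ /hasPn/(_ _ r't)]; rewrite rr' /= rs.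
Qed.

Lemma odd_sum_unit (I : eqType) (l : seq I) (F : I -> int) :
  {in l, forall e, absz (F e) = 1%N} ->
  odd (absz (\sum_(e <- l) F e)) = odd (size l).
Proof.
elim: l => [|e l IHl] F1; first by rewrite big_nil.
rewrite big_cons /= -IHl => [|x xl]; last by rewrite F1 // inE xl orbT.
have := F1 e (mem_head _ _); move: (F e) (\sum_(_ <- _) _) => a b; lia.
Qed.

(** The intersection index of the components [s] and [t] is minus the label
    change along [s]: a crossing of [s] with itself changes the label by 1 and
    by -1, a crossing of [s] with [t] changes it by minus its index.  As the
    indices are 1 or -1, the number of crossings of [s] with [t] has the parity
    of their sum. *)
Lemma mutual_complement w p s t : well_formed w ->
  perm_eq w [:: p, partner p & s ++ t] ->
  let M := [seq e <- classical w | passes s Over e && passes t Under e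
                                   || passes t Over e && passes s Under e] in
  \sum_(e <- M) (if passes s Over e then sgn w e else - sgn w e) = - label_sum s
  /\ odd (size M) = odd (absz (label_sum s)).
Proof.
move=> wf wE /=; set M := filter _ _.
have fresh := fresh_pair wf wE; rewrite map_cat mem_cat negb_or in fresh.
case/andP: fresh => ps pt.
have sw : {subset s <= w}.
  by move=> x xs; rewrite (perm_mem wE) !inE mem_cat xs !orbT.
have us : uniq s.
  have := well_formed_uniq wf; rewrite (perm_uniq wE) /= => /and3P[_ _].
  by rewrite cat_uniq => /and3P[].
have sumM : \sum_(e <- M) (if passes s Over e then sgn w e else - sgn w e)
    = - label_sum s.
  rewrite -(label_sum_passes wf sw us) big_filter big_mkcond.
  rewrite [LHS]big_seq [RHS]big_seq; apply: eq_bigr => e ew.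
  case: (eqVneq e (name p)) => [->|ep].
    by rewrite !(passes_fresh _ ps) !(passes_fresh _ pt) subrr mulr0.
  rewrite !(passes_complement wf wE _ ew ep) //.
  by case: (passes s Over e); case: (passes s Under e) => /=; lia.
split=> //; rewrite -abszN -sumM odd_sum_unit // => e _.
by rewrite /sgn; case: (_ \in w); case: (passes _ _ _).
Qed.

Lemma index_shadow u v d c : c \notin map name u ->
  index (c, d) (shadow (u ++ v)) = (size u + index (c, d) (shadow v))%N.
Proof.
move=> cu; rewrite /shadow map_cat index_cat size_map ifN //.
apply: contra cu => /mapP[p pu] [pE].
by apply/mapP; exists p; rewrite // /name -pE.
Qed.

(** In this section [q] is the first of the two passages through its crossing;
    the loop [v] is then the closed component of the smoothing. *)
Section Split.
Variables (w u v t : code) (q : passage).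
Hypotheses (wE : w = u ++ q :: v ++ partner q :: t) (wf : well_formed w).
Hypothesis q_classical : is_classical q.

Let q_fresh : name q \notin map name (u ++ v ++ t).
Proof.
apply: (fresh_pair wf); rewrite wE; apply/permP=> a.
by rewrite !count_cat /= !count_cat /=; lia.
Qed.

Let fresh : [/\ name q \notin map name u, name q \notin map name v
  & name q \notin map name t].
Proof. by move: q_fresh; rewrite !map_cat !mem_cat !negb_or => /and3P. Qed.

Lemma position_split :
  position w (name q) (dir q) = size u
  /\ position w (name q) (~~ dir q) = (size u + (size v).+1)%N.
Proof.
have [qu qv _] := fresh.
rewrite wE /position !index_shadow //=.
have -> : q.1 = (name q, dir q) by case: (q) => [[]].
rewrite eqxx addn0; split=> //.
have -> : ((name q, dir q) == (name q, ~~ dir q)) = false.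
  by rewrite xpair_eqE eqxx; case: dir.
by rewrite -/(shadow _) index_shadow //= /partner /= eqxx addn0 addnS.
Qed.

Lemma weight_split :
  weight w (name q)
  = sgn w (name q) * (if dir q then - label_sum v else label_sum v).
Proof.
have [i j] := position_split; rewrite /weight; congr (_ * _).
have li : label w (size u) = label_sum u.
  by rewrite /label wE take_size_cat.
have lj : label w (size u + (size v).+1)
    = label_sum u + label_step q + label_sum v.
  have -> : (size u + (size v).+1)%N = size (u ++ q :: v) by rewrite size_cat.
  rewrite /label wE -cat_cons catA take_size_cat // -/(label_sum _) !label_sumE.
  by rewrite addrA.
have qs : label_step q = if dir q then -1 else 1.
  by rewrite /label_step -/(is_classical q) q_classical.
by move: i j; case: (dir q) qs lj => qs lj /= -> ->; rewrite li lj qs; lia.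
Qed.

Lemma flat_weight_split :
  flat_weight 0 w (name q) = if dir q then - label_sum v else label_sum v.
Proof.
have [qu qv qt] := fresh.
rewrite wE flat_weight_cat /= flat_weight_cat /= !flat_weight_fresh //.
rewrite ![name _]/= !eqxx /is_classical /label_step -/(is_classical q).
rewrite /partner /ht /dir /= -/(ht q) -/(dir q).
move: q_classical; rewrite /is_classical.
by case: (ht q) => //; case: (dir q) => _ /=; lia.
Qed.

Lemma inner_split : inner w (name q) = v.
Proof.
have [i j] := position_split; rewrite /inner.
have -> : minn (position w (name q) true) (position w (name q) false) = size u.
  by move: i j; case: (dir q) => /= -> ->; lia.
have -> : maxn (position w (name q) true) (position w (name q) false)
    = (size u + (size v).+1)%N.
  by move: i j; case: (dir q) => /= -> ->; lia.
have -> : (size u + (size v).+1)%N = size (u ++ q :: v) by rewrite size_cat.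
rewrite wE -cat_cons catA take_size_cat //.
by rewrite -cat1s catA drop_size_cat // size_cat addn1.
Qed.

Lemma outer_split : outer w (name q) = u ++ t.
Proof.
have [i j] := position_split; rewrite /outer.
have -> : minn (position w (name q) true) (position w (name q) false) = size u.
  by move: i j; case: (dir q) => /= -> ->; lia.
have -> : maxn (position w (name q) true) (position w (name q) false)
    = (size u + (size v).+1)%N.
  by move: i j; case: (dir q) => /= -> ->; lia.
rewrite {1}wE take_size_cat //; congr (_ ++ _).
have -> : w = (u ++ q :: v ++ [:: partner q]) ++ t.
  by rewrite wE -catA /= -catA.
by rewrite drop_size_cat // size_cat /= size_cat /=; lia.
Qed.

Lemma components_split :
  (comp1 w (name q), comp2 w (name q))
  = if dir q (+) (sgn w (name q) == 1) then (v, u ++ t) else (u ++ t, v).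
Proof.
have [i j] := position_split.
rewrite /comp1 /comp2 /left_comp /right_comp inner_split outer_split.
have -> : (position w (name q) true < position w (name q) false)%N = dir q.
  by move: i j; case: (dir q) => /= -> ->; lia.
by case: (dir q); case: (sgn w _ == 1).
Qed.

(** The labels of the two arcs entering the crossing differ by the label change
    along [v] and the label step of [q].  Since the label change along the whole
    curve is 0, the weight is the label change along the first component in all
    four cases for the direction and the sign. *)
Lemma intersection_split :
  intersection_index w (name q) = - weight w (name q)
  /\ even_crossing w (name q) = ~~ odd (absz (weight w (name q))).
Proof.
have total : label_sum (u ++ t) = - label_sum v.
  have := label_sum_well_formed wf; rewrite wE !label_sumE label_step_partner.
  by lia.
have wP s s' : (s, s') = (v, u ++ t) \/ (s, s') = (u ++ t, v) ->
    perm_eq w [:: q, partner q & s ++ s'].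
  by case=> -[-> ->]; rewrite wE; apply/permP=> a;
    rewrite /= !count_cat /= ?count_cat /=; lia.
have [comp1E w_perm] : label_sum (comp1 w (name q)) = weight w (name q)
    /\ perm_eq w [:: q, partner q & comp1 w (name q) ++ comp2 w (name q)].
  move: weight_split components_split; rewrite /sgn.
  by case: (_ \in w); case: (dir q) => /= -> [-> ->];
    rewrite ?total; split; try (apply: wP; by auto); lia.
have [sumE oddE] := mutual_complement wf w_perm.
split; first by rewrite /intersection_index /mutual /ind sumE comp1E.
by rewrite /even_crossing /mutual oddE comp1E.
Qed.
End Split.

(** * The polynomial as a sum over flat weights *)

(** The contribution g(n) of a positive crossing of weight n: its intersection
    index is -n, and it is even iff n is. *)
Definition parity_term (n : int) : laurent :=
  - (n%:~R * (if odd (absz n) then vary else varx) ^ n).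

Lemma intersection_index_weight w c : well_formed w -> c \in classical w ->
  intersection_index w c = - weight w c
  /\ even_crossing w c = ~~ odd (absz (weight w c)).
Proof.
move=> wf /names_atP[p pw [hp <-]].
have [q [u [v [t [qp wE _]]]]] := well_formed_split wf pw.
have -> : name p = name q by case: qp => ->.
apply: intersection_split wE wf _.
by case: qp => ->; rewrite /is_classical /partner /ht /= -/(ht p) hp.
Qed.

Lemma signed_term_weight (A : zmodType) (g : int -> A) w p :
  well_formed w -> p \in w -> dir p -> is_classical p ->
  signed_term g (flat_weight 0 w (name p)) p
  = g (weight w (name p)) *~ sgn w (name p).
Proof.
move=> wf pw dp clp; have [q [u [v [t [qp wE _]]]]] := well_formed_split wf pw.
have qn : name q = name p by case: qp => ->.
have clq : is_classical q.
  move: clp; case: qp => -> //.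
  by rewrite /is_classical /partner /ht /=; case: p.2.
rewrite -qn (weight_split wE wf clq) (flat_weight_split wE wf clq) qn.
rewrite (sgn_passage wf pw clp) dp /signed_term dp.
move: clp; rewrite /is_classical; case: (ht p) => //= _.
  by rewrite mul1r.
by rewrite mulN1r.
Qed.

(** The names of the passages from bottom left to top right and those of the
    over-passages enumerate the same crossings. *)
Lemma index_sum_weight (A : zmodType) (g : int -> A) w : well_formed w ->
  index_sum g w = \sum_(c <- classical w) g (weight w c) *~ sgn w c.
Proof.
move=> wf; pose fwd := [seq p <- w | dir p && is_classical p].
have -> : index_sum g w = \sum_(c <- map name fwd) g (weight w c) *~ sgn w c.
  rewrite big_map big_filter /index_sum [RHS]big_mkcond.
  apply: eq_big_seq => p pw; case: ifP => [/andP[dp clp]|].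
    exact: signed_term_weight.
  by rewrite /signed_term /is_classical; case: (dir p); case: (ht p).
apply: perm_big; apply: uniq_perm.
- rewrite map_inj_in_uniq ?filter_uniq ?well_formed_uniq // => p q.
  rewrite !mem_filter => /andP[/andP[dp _] pw] /andP[/andP[dq _] qw] pq.
  case: (same_crossing wf qw pw pq) => // pE.
  by move: dp dq; rewrite pE /partner /dir /= => /negPf->.
- exact: names_at_uniq wf _ (well_formed_uniq wf) _.
move=> n; apply/mapP/names_atP => [[p]|[p pw [hp <-]]].
  rewrite mem_filter => /andP[/andP[dp clp] pw] ->.
  have [_ p'w] := names_count wf pw.
  case hp : (ht p) clp; rewrite /is_classical hp // => _; first by exists p.
  by exists (partner p); rewrite // /partner /ht /= -/(ht p) hp.
have [_ p'w] := names_count wf pw.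
case dp : (dir p); [exists p => // | exists (partner p) => //];
  rewrite mem_filter ?p'w ?pw ?andbT.
  by rewrite dp /is_classical hp.
by rewrite /is_classical /partner /dir /ht /= -/(dir p) -/(ht p) dp hp.
Qed.

Lemma diagram_well_formed (D : diagram) : well_formed D.
Proof. by case: D => w /= /andP[]. Qed.

Lemma parity_polynomialE (D : diagram) :
  parity_polynomial D = index_sum parity_term D.
Proof.
have wf := diagram_well_formed D; rewrite index_sum_weight //.
rewrite /parity_polynomial [X in X + _]big_mkcond [X in _ + X]big_mkcond.
rewrite -big_split; apply: eq_big_seq => c cD /=.
have [-> ->] := intersection_index_weight wf cD; rewrite /parity_term.
case: (odd _) => /=; rewrite ?add0r ?addr0 -mulrzr mulrN rmorphN /= intrM; ring.
Qed.

(** * Derivatives *)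

Definition flat (p : passage) : nat * bool * bool := (p.1, is_classical p).

Lemma flat_weight_flat a u v n :
  map flat u = map flat v -> flat_weight a u n = flat_weight a v n.
Proof.
elim: u v a => [|p u IHu] [|q v] a //= [pq cl uv].
by rewrite (IHu v _ uv) /label_step -/(is_classical p) -/(is_classical q) cl
  /name /dir pq.
Qed.

Lemma name_resolve x b p : name (resolve_passage x b p) = name p.
Proof. by rewrite /name resolve_passage1. Qed.

(** Flat weights are the same in all four resolutions, so each crossing
    contributes a term that depends on at most one of the two choices of sign;
    such terms disappear from the alternating sum. *)
Lemma index_sum_resolve2 (A : zmodType) (g : int -> A) (x y : nat) (w : code) :
  let V b c := index_sum g (resolve_code y c (resolve_code x b w)) in
  V true true - V true false = V false true - V false false.
Proof.
move=> V; pose r b c p := resolve_passage y c (resolve_passage x b p).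
pose N := flat_weight 0 (resolve_code y true (resolve_code x true w)).
have VE b c : V b c = \sum_(p <- w) signed_term g (N (name p)) (r b c p).
  rewrite /V /index_sum !big_map; apply: eq_bigr => p _.
  rewrite !name_resolve; congr signed_term.
  apply: flat_weight_flat; rewrite /resolve_code -!map_comp.
  apply: eq_map => -[[z d] h] /=; rewrite /flat !resolve_passage1; congr (_, _).
  rewrite /resolve_passage /is_classical /name /dir /ht /=.
  by case: h; case: (z =P x) => //= zx; case: b; case: d;
    rewrite /= ?zx; case: eqP => //=; case: c.
rewrite !VE -!sumrB; apply: eq_bigr => p _; rewrite /r /resolve_passage.
case: (boolP ((name p == x) && (ht p == Singular))) => [|_].
  move=> _.
  have nS b : ((if dir p == b then Over else Under) == Singular) = false.
    by case: (dir p == b).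
  by rewrite [in LHS]/ht [in RHS]/ht /= !nS !andbF !subrr.
by [].
Qed.

Lemma code_resolve x b (D : diagram) :
  resolve x b D = resolve_code x b D :> code.
Proof. by case: D. Qed.

Lemma filter_singular_resolve x b w :
  [seq p <- resolve_code x b w | ht p == Singular]
  = [seq p <- w | (name p != x) && (ht p == Singular)].
Proof.
elim: w => //= p w ->; rewrite /resolve_passage.
case: (name p == x) => //=.
case: (boolP (ht p == Singular)) => [_|/negPf->] //=.
by rewrite /ht /=; case: (dir p == b).
Qed.

Lemma derivative_parity2 (D : diagram) : derivative parity_polynomial 2 D = 0.
Proof.
rewrite /= /first_singular !code_resolve !filter_singular_resolve.
set x := name _; set y := name _.
rewrite !parity_polynomialE !code_resolve.
by have /= -> := index_sum_resolve2 parity_term y x D; rewrite subrr.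
Qed.

Lemma derivative_parity n (D : diagram) : (1 < n)%N ->
  derivative parity_polynomial n D = 0.
Proof.
elim: n D => [|[|[|n]] IHn] D // _; first exact: derivative_parity2.
by rewrite [LHS]/= -/(derivative _ n.+2) -!/(derivative _ n.+2 _) !IHn ?subrr.
Qed.

Lemma singular_partner p : (ht (partner p) == Singular) = (ht p == Singular).
Proof. by case: p => [[x d] []]. Qed.

Lemma nsing_move w w' : move w w' -> nsing w = nsing w'.
Proof.
rewrite /nsing; case=> {w w'}.
- by move=> f w _; rewrite count_map; apply: eq_count.
- move=> p w1 w2 hp; rewrite !count_cat.
  by case: p hp => [[x []] []].
- move=> p q b s1 s2 w1 w2 w3 hp hq _ s12; rewrite !count_cat.
  pose a (r : passage) := dir r && (ht r == Singular); rewrite -!/a.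
  have nq r : ht r = ht p -> (a r = false) * (a (partner r) = false).
    by move=> hr; rewrite /a singular_partner hr (negPf hp) !andbF.
  have [ap ap'] := nq p erefl; have [aq aq'] := nq q hq.
  by case: (perm_eq_pair s12) => -[-> ->]; case: (b);
    rewrite /= ap ap' aq aq'.
- move=> p q r b c s1 s2 s3 w1 w2 w3 w4 _ _ _ _ _.
  by rewrite !count_cat !count_rev.
- move=> p w1 w2 hp; rewrite /= !count_cat /=.
  by rewrite singular_partner hp !andbF.
- move=> p w1 w2 hp; rewrite !count_cat /= count_cat /=.
  by rewrite singular_partner hp !andbF; lia.
move=> p q b s1 s2 s1' s2' w1 w2 w3 hp hq _ s12; rewrite !count_cat.
have np : (ht p == Singular) = false by case: (ht p) hp.
by case: (perm_eq_pair s12) => -[[-> ->] [-> ->]]; case: (b);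
  rewrite /= !singular_partner np !andbF; lia.
Qed.

(** A singular crossing is counted by its passage from bottom left to top right;
    if there is only one such passage, all singular passages share its name. *)
Lemma resolve_single b w : well_formed w -> nsing w = 1%N ->
  resolve_code (first_singular w) b w = resolve_all b w.
Proof.
move=> wf ns1; apply/eq_in_map => p pw.
suff single : ht p == Singular -> name p = first_singular w.
  rewrite /resolve_passage /resolve_all_passage.
  case: ifP => [/andP[/eqP xE ->]|].
    by rewrite -xE; case: p {pw single xE} => [[]].
  case: ifP => [hp|_ _]; last by case: p {pw single}.
  by rewrite single ?hp // eqxx.
move=> hp; rewrite /first_singular; set q := head _ _.
have : q \in [seq p <- w | ht p == Singular].
  rewrite /q; have : p \in [seq p <- w | ht p == Singular].
    by rewrite mem_filter hp.
  by case: filter => //= r s _; rewrite mem_head.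
rewrite mem_filter => /andP[hq qw].
pose fwd r := if dir r then r else partner r.
have fwdP r : r \in w -> ht r == Singular ->
    fwd r \in [seq p <- w | dir p && (ht p == Singular)].
  move=> rw hr; have [_ r'w] := names_count wf rw.
  rewrite mem_filter /fwd; case dr: (dir r); first by rewrite dr hr.
  by rewrite r'w /partner /dir /ht /= -/(dir r) -/(ht r) dr (eqP hr).
have fname r : name (fwd r) = name r by rewrite /fwd; case: (dir r).
rewrite -fname -(fname q); congr name.
move: (fwdP p pw hp) (fwdP q qw hq) ns1; rewrite /nsing -size_filter.
by case: filter => [|r [|//]] //; rewrite !inE => /eqP-> /eqP->.
Qed.

Lemma extension_parity (D : diagram) :
  extension parity_polynomial D =
  match nsing D with
  | 0 => index_sum parity_term (resolve_all true D)
  | 1 => index_sum parity_term (resolve_all true D)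
         - index_sum parity_term (resolve_all false D)
  | _ => 0
  end.
Proof.
rewrite /extension; case ns: (nsing D) => [|[|n]].
- by rewrite resolve_all_id ?diagram_well_formed //= parity_polynomialE.
- by rewrite /= !parity_polynomialE !code_resolve !resolve_single
    ?diagram_well_formed.
exact: derivative_parity.
Qed.

Lemma parity_term0 : parity_term 0 = 0.
Proof. by rewrite /parity_term mul0r oppr0. Qed.

Lemma extension_parity_equivalent (D D' : diagram) : equivalent D D' ->
  extension parity_polynomial D = extension parity_polynomial D'.
Proof.
elim=> {D D'} [D D' mv|D|D D' _ ->|D D' D'' _ -> _ ->] //.
rewrite !extension_parity (nsing_move mv).
have E b := index_sum_move b parity_term0 mv (diagram_well_formed D)
  (diagram_well_formed D').
by rewrite !E.
Qed.

(** * A knotoid with one singular crossing and nonzero derivative *)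

(** The simplest spherical knotoid diagram with two interlaced crossings.  The
    flat weight of its singular crossing 0 is -1. *)
Definition bigon_knotoid : code :=
  [:: (0%N, true, Singular); (1%N, false, Under);
      (0%N, false, Singular); (1%N, true, Over)].

(** This reduces counting faces to tracing a face from each representative and
    to telling the representatives apart by an invariant. *)
Lemma fcard_orbits (T : finType) (f : T -> T) (r : seq T) : injective f ->
  uniq r -> {in r &, forall x y, fconnect f x y -> x = y} ->
  (forall x, exists2 y, y \in r & fconnect f y x) ->
  fcard f predT = size r.
Proof.
move=> f_inj ur r_sep r_cover.
have fsym : connect_sym (frel f) by exact: fconnect_sym.
rewrite -(size_map (froot f)) /n_comp_mem -(card_uniqP _).
  apply: eq_card => x; rewrite !inE andbT.
  apply/idP/mapP => [/eqP xr|[y yr ->]].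
    have [y yr yx] := r_cover x; exists y => //.
    by rewrite -[LHS]xr (fingraph.rootP fsym yx).
  exact: roots_root.
rewrite map_inj_in_uniq // => x y xr yr /(fingraph.rootP fsym); exact: r_sep.
Qed.

(** The face permutation of [bigon_knotoid], made computable: an arc is
    represented by its number. *)
Definition bigon_face (e : nat * bool) : nat * bool :=
  match e with
  | (0, false) => (0, true) | (0, true) => (3, true)
  | (3, true) => (2, true) | (2, true) => (0, false)
  | (1, false) => (2, false) | (2, false) => (4, true)
  | (4, true) => (4, false) | (4, false) => (1, false)
  | (1, true) => (3, false) | (3, false) => (1, true)
  | _ => e
  end%N.

(** The numbers of the three faces, to tell the orbits apart. *)
Definition bigon_face_label (e : nat * bool) : nat :=
  match e with
  | (1, true) | (3, false) => 2 | (0, _) | (3, true) | (2, true) => 0 | _ => 1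
  end%N.

Lemma bigon_planar : planar (shadow bigon_knotoid).
Proof.
set f := shadow _; pose T := ('I_(size f).+1 * bool)%type.
pose nx : T -> T := @face_next f.
pose val2 (e : T) : nat * bool := (val e.1, e.2).
have val2_inj : injective val2.
  by move=> [i b] [j c] [/val_inj-> ->].
have darts (P : nat * bool -> bool) :
    P (0, false)%N && P (0, true)%N && P (1, false)%N && P (1, true)%N
    && P (2, false)%N && P (2, true)%N && P (3, false)%N && P (3, true)%N
    && P (4, false)%N && P (4, true)%N -> forall e, P (val2 e).
  move=> H [[i Hi] b]; rewrite /val2 /=; move: H Hi.
  by do 9 case/andP; case: b; case: i => [|[|[|[|[|i]]]]].
have nxE e : val2 (nx e) = bigon_face (val2 e).
  case: e => [[i Hi] b]; rewrite /nx /face_next /val2 /=.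
  by case: b; case: i Hi => [|[|[|[|[|i]]]]] //= Hi; rewrite /= inordK.
have iterE n e : val2 (iter n nx e) = iter n bigon_face (val2 e).
  by elim: n => //= n IHn; rewrite nxE IHn.
(* The faces have 4, 4 and 2 sides. *)
have nx4 e : iter 4 nx e = e.
  apply/val2_inj; rewrite iterE; apply/eqP; move: e.
  exact: (darts (fun e => iter 4 bigon_face e == e)).
have nx_inj : injective nx.
  by apply: (can_inj (g := iter 3 nx)) => e; rewrite -[RHS]nx4.
have labelE e : invariant nx (bigon_face_label \o val2) e.
  change (bigon_face_label (val2 (nx e)) == bigon_face_label (val2 e)).
  rewrite nxE; move: e.
  exact: (darts (fun d =>
    bigon_face_label (bigon_face d) == bigon_face_label d)).
pose rep := [:: (inord 0, true) : T; (inord 4, true); (inord 3, false)].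
have repE : map val2 rep = [:: (0, true); (4, true); (3, false)]%N.
  by rewrite /= /val2 /= !inordK.
rewrite /planar -/nx (fcard_orbits (r := rep) nx_inj) //.
- by rewrite -(map_inj_uniq val2_inj) repE.
- move=> x y xr yr xy.
  have {xy} : bigon_face_label (val2 x) = bigon_face_label (val2 y).
    exact: (fconnect_invariant labelE xy).
  move=> xy; apply: val2_inj; move: (map_f val2 xr) (map_f val2 yr) xy.
  by rewrite repE !inE; case/or3P=> /eqP->; case/or3P=> /eqP->.
move=> e.
have : has (fun y => val2 e \in traject bigon_face y 4) (map val2 rep).
  rewrite repE; move: e; apply: (darts (fun d =>
    has (fun y => d \in traject bigon_face y 4)
      [:: (0, true); (4, true); (3, false)]%N)).
  by [].
case/hasP=> _ /mapP[y yr ->] /trajectP[n _]; rewrite -iterE => /val2_inj->.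
by exists y => //; apply: fconnect_iter.
Qed.

(** The sum is y^-1 - y. *)
Lemma parity_term_nonzero : parity_term (-1) + parity_term 1 <> 0.
Proof.
rewrite /parity_term /= expr1z exprN1 mul1r mulN1r opprK => /eqP.
rewrite subr_eq0 => /eqP yV.
have y0 : vary != 0 by rewrite /vary tofrac_eq0 polyX_eq0.
have : vary ^+ 2 == 1 by rewrite expr2 -{1}yV mulVf.
rewrite /vary -tofracXn -tofrac1 tofrac_eq.
move=> /eqP/(congr1 (size : {poly _} -> nat)).
by rewrite size_polyXn size_poly1.
Qed.

Lemma bigon_nonzero :
  exists D : diagram, nsing D = 1%N /\ extension parity_polynomial D <> 0.
Proof.
have bd : is_diagram bigon_knotoid by rewrite /is_diagram bigon_planar.
exists (Diagram bd); split=> //; rewrite extension_parity [nsing _]/=.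
rewrite /index_sum /= !big_cons !big_nil.
rewrite /signed_term /is_classical /label_step /=.
(* Crossing 1 contributes [v] to both resolutions; crossing 0 contributes [u] to
   the positive one and [- v] to the negative one. *)
set u := parity_term (-1); set v := parity_term 1.
rewrite !add0r !addr0 addNr subr0; exact: parity_term_nonzero.
Qed.

Theorem theorem3p2 : vassiliev_of_order parity_polynomial 1.
Proof.
split; [exact: extension_parity_equivalent | | exact: bigon_nonzero].
by move=> D; rewrite extension_parity; case: (nsing D) => [|[|n]].
Qed.
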